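(* For every internal node $\mathsf{n}$ of the refinement $\mathcal{R}(Q)$ and every polynomial distribution $\mathsf{p}\in\mathsf{P}(\mathsf{n})$, the $hp$-enrichment function $\xi_{\mathsf{n},\mathsf{p}}:\Omega\to\mathbb{R}$ is continuous in $\Omega$ and $$\operatorname{supp}(\xi_{\mathsf{n},\mathsf{p}})=T(\mathsf{n}).$$
   Context: $\Omega\subset\mathbb{R}^d$ is a bounded Lipschitz domain with a decomposition $\mathcal{Q}$ into transformed hexahedra, i.e. each $Q\in\mathcal{Q}$ is the image of $\widehat Q:=[-1,1]^d$ under a bijective element mapping $F_Q:\widehat Q\to Q$ (a homeomorphism). Fix $Q\in\mathcal{Q}$. One-dimensional functions on $[-1,1]$: $\psi_0(t):=\frac12(1-t)$, $\psi_1(t):=\frac12(1+t)$, $\psi_j(t):=\int_{-1}^tL_{j-1}(s)\,ds$ for $j\ge2$, where $L_j$ is the $j$-th Legendre polynomial with $L_j(-1)=(-1)^j$. For $\mathsf{j}\in\mathbb{N}_0^d$, $\widehat\psi_{\mathsf{j}}(x):=\prod_{k=1}^d\psi_{j_k}(x_k)$, $x\in\widehat Q$. Refinement. Given a dividing point $\hat z\in(-1,1)^d$, $\widehat Q$ is divided into the $2^d$ sub-hexahedra $\widehat T_{\mathsf{i}}$, $\mathsf{i}\in\{0,1\}^d$, where $\widehat T_{\mathsf{i}}$ is the product of the intervals $[-1,\hat z_k]$ if $i_k=0$ and $[\hat z_k,1]$ if $i_k=1$. $\mathcal{R}(Q):=\{T_{\mathsf{i}}\}$ with $T_{\mathsf{i}}:=F_Q(\widehat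 T_{\mathsf{i}})$; $F_{\mathsf{i}}:\widehat Q\to T_{\mathsf{i}}$ is the bijection obtained by composing $F_Q$ with the coordinatewise increasing affine map $\widehat Q\to\widehat T_{\mathsf{i}}$. Set $\zeta_{\mathsf{j}}^{\mathsf{i}}:=\widehat\psi_{\mathsf{j}}\circ F_{\mathsf{i}}^{-1}:T_{\mathsf{i}}\to\mathbb{R}$. Internal nodes. For $r\in\{0,\dots,d\}$, an $r$-dimensional internal node (an $r$-dimensional node of the mesh $\mathcal{R}(Q)$ not lying on $\partial Q$) is identified with a pair $\mathsf{n}=(\mathsf{a},\ell)$, where $\mathsf{a}=(a_1,\dots,a_r)\in\{1,\dots,d\}^r$ with $a_1<\dots<a_r$ (orientation tuple) and $\ell=(\ell_1,\dots,\ell_r)\in\{0,1\}^r$ (location tuple). Let $A(\mathsf{a}):=\{a_1,\dots,a_r\}$; entries of $\ell$ and of $\mathsf{p}$ below are attached to the directions in $A(\mathsf{a})$, and for $k=a_m\in A(\mathsf{a})$ we write $\ell_k$, $p_k$ for the $m$-th entry. Set $$\mathsf{I}(\mathsf{n}):=\{\mathsf{i}\in\{0,1\}^d: i_k=\ell_k\text{ for each }k\in A(\mathsf{a})\},\qquad T(\mathsf{n}):=\bigcup_{\mathsf{i}\in\mathsf{I}(\mathsf{n})}T_{\mathsf{i}}.$$ $hp$-enrichment functions. $\mathsf{P}(\mathsf{n})$ is a finite set of polynomial distributions $\mathsf{p}=(p_1,\dots,p_r)\in\mathbb{N}_0^r$ with all entries $\ge2$. For $\mathsf{i}\in\mathsf{I}(\mathsf{n})$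 let $\mathsf{j}(\mathsf{i},\mathsf{p})=(j_1,\dots,j_d)$ with $j_k:=p_k$ if $k\in A(\mathsf{a})$ and $j_k:=1-i_k$ if $k\notin A(\mathsf{a})$. Then $$\xi_{\mathsf{n},\mathsf{p}}(x):=\begin{cases}\zeta^{\mathsf{i}}_{\mathsf{j}(\mathsf{i},\mathsf{p})}(x),&x\in T_{\mathsf{i}},\ \mathsf{i}\in\mathsf{I}(\mathsf{n}),\\0,&x\in\Omega\setminus T(\mathsf{n}).\end{cases}$$ *)

(* Defs.v *)
From HB Require Import structures.
From mathcomp Require Import all_boot all_order all_algebra.
From mathcomp Require Import all_classical all_reals all_analysis.

Set Implicit Arguments.
Unset Strict Implicit.
Unset Printing Implicit Defensive.

Import Order.TTheory GRing.Theory Num.Theory.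
Import numFieldNormedType.Exports.

Local Open Scope classical_set_scope.
Local Open Scope ring_scope.

Section Mesh.
Variables (R : realType) (d : nat).
Implicit Types (Omega Q : set 'rV[R]_d).

(* Near each boundary point, after a rigid change of coordinates, Omega is the
   strict epigraph, in some coordinate direction k, of a Lipschitz function of
   the other coordinates. *)
Definition lipschitz_boundary Omega : Prop :=
  forall x0, (closure Omega `\` Omega°) x0 ->
  exists (r : R) (U : 'M[R]_d) (k : 'I_d) (phi : 'rV[R]_d.-1 -> R^o),
    [/\ 0 < r, U *m U^T = 1%:M, lipschitz phi &
        forall x, ball x0 r x ->
          (Omega x <-> phi (col' k (x *m U)) < (x *m U) 0 k)].

Record bounded_lipschitz_domain Omega : Prop := {
  domain_nonempty : Omega !=set0 ;
  domain_open : open Omega ;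
  domain_connected : connected Omega ;
  domain_bounded : bounded_set Omega ;
  domain_lipschitz : lipschitz_boundary Omega }.

Definition refcube : set 'rV[R]_d :=
  [set x | forall k, x 0 k \in `[(-1 : R), 1]].

Definition refcube_inv (f : 'rV[R]_d -> 'rV[R]_d) : 'rV[R]_d -> 'rV[R]_d :=
  'pinv_(fun=> 0) refcube f.

(* f is only relevant on the reference cube; its values elsewhere are junk. *)
Record element_mapping Q (f : 'rV[R]_d -> 'rV[R]_d) : Prop := {
  element_mapping_bij : set_bij refcube Q f ;
  element_mapping_continuous : {within refcube, continuous f} ;
  element_mapping_inv_continuous : {within Q, continuous (refcube_inv f)} }.

(* The boundary of the transformed hexahedron f @` refcube, that is, the union
   of its faces. For an element mapping f it coincides, by invariance of
   domain, with the topological boundary in R^d. *)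
Definition element_boundary (f : 'rV[R]_d -> 'rV[R]_d) : set 'rV[R]_d :=
  f @` (refcube `\` refcube°).

(* A finite family of closed transformed hexahedra that cover the closure of
   Omega and overlap at most along their boundaries; hanging nodes are
   allowed. *)
Record decomposition Omega (Qs : set (set 'rV[R]_d))
    (F : set 'rV[R]_d -> 'rV[R]_d -> 'rV[R]_d) : Prop := {
  decomposition_finite : finite_set Qs ;
  decomposition_mapping : forall Q, Qs Q -> element_mapping Q (F Q) ;
  decomposition_cover : \bigcup_(Q in Qs) Q = closure Omega ;
  decomposition_overlap : forall Q Q', Qs Q -> Qs Q' -> Q <> Q' ->
    Q `&` Q' `<=` element_boundary (F Q) `&` element_boundary (F Q') }.

(* The domain of h is Omega (values of h outside Omega are ignored); the
   closure is taken in R^d. *)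
Definition support_in Omega (h : 'rV[R]_d -> R) : set 'rV[R]_d :=
  closure [set x | Omega x /\ h x != 0].

End Mesh.

Section Shape.
Variable R : realType.

(* Rodrigues' formula. *)
Definition legendre (j : nat) : {poly R} :=
  ((2 ^ j * j`!)%:R)^-1 *: (('X^2 - 1) ^+ j)^`(j).

Definition psi (j : nat) (t : R) : R :=
  match j with
  | 0 => (1 - t) / 2
  | 1 => (1 + t) / 2
  | j'.+2 =>
      (\int[@lebesgue_measure R]_(s in `[(-1)%R, t]) (legendre j'.+1).[s])%R
  end.

Definition psihat d (j : 'I_d -> nat) (x : 'rV[R]_d) : R :=
  \prod_(k < d) psi (j k) (x 0 k).

End Shape.

(* {0,1}^d, with false = 0 and true = 1. *)
Notation multibit d := {ffun 'I_d -> bool}.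

(* The geometric node is identified with its orientation tuple a and location
   tuple l; directions are numbered from 0. Strict monotonicity of a forces
   node_dim <= d. *)
Record internal_node (d : nat) := InternalNode {
  node_dim : nat ;
  orientation : node_dim.-tuple 'I_d ;
  location : node_dim.-tuple bool ;
  orientation_sorted : sorted (fun k k' : 'I_d => (k < k')%N) orientation }.

Definition node_adjacent d (n : internal_node d) : pred (multibit d) :=
  fun i => [forall m, i (tnth (orientation n) m) == tnth (location n) m].

Definition shape_index d (n : internal_node d) (i : multibit d)
    (p : (node_dim n).-tuple nat) (k : 'I_d) : nat :=
  if k \in orientation n then nth 0%N p (index k (orientation n))
  else (1 - i k)%N.

Section Refinement.
Variables (R : realType) (d : nat).
Variables (f : 'rV[R]_d -> 'rV[R]_d) (z : 'rV[R]_d).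
Implicit Types (i : multibit d) (n : internal_node d).

Definition edge_lo i (k : 'I_d) : R := if i k then z 0 k else -1.
Definition edge_hi i (k : 'I_d) : R := if i k then 1 else z 0 k.

Definition subcube i : set 'rV[R]_d :=
  [set x | forall k, x 0 k \in `[edge_lo i k, edge_hi i k]].

Definition subelement i : set 'rV[R]_d := f @` subcube i.

Definition submap i (x : 'rV[R]_d) : 'rV[R]_d :=
  f (\row_k (edge_lo i k + (x 0 k + 1) / 2 * (edge_hi i k - edge_lo i k))).

(* Meaningful on subelement i only. *)
Definition zeta i (j : 'I_d -> nat) : 'rV[R]_d -> R :=
  psihat j \o refcube_inv (submap i).

Definition node_patch n : set 'rV[R]_d :=
  \bigcup_(i in [set i | node_adjacent n i]) subelement i.

(* If x lies in several subelements of the patch, one of them is picked; that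
   the value does not depend on the choice is to be proved. *)
Definition enrichment n (p : (node_dim n).-tuple nat) (x : 'rV[R]_d) : R :=
  if [pick i | node_adjacent n i && (x \in subelement i)] is Some i
  then zeta i (shape_index i p) x else 0.

End Refinement.

(* Main.v *)
Require Import Defs.
From HB Require Import structures.
From mathcomp Require Import all_boot all_order all_algebra.
From mathcomp Require Import all_classical all_reals all_analysis.
From mathcomp Require Import ring lra.
Import Order.TTheory GRing.Theory Num.Theory.
Import numFieldNormedType.Exports.
Local Open Scope classical_set_scope.
Local Open Scope ring_scope.

(** On the reference cube the pieces that define the enrichment function are one
    and the same tensor product. In a direction outside the orientation tuple,
    the factors (1 + t) / 2 and (1 - t) / 2 of the two adjacent sub-hexahedra,
    read in global coordinates, are the two branches of the hat function with
    peak at the dividing point. In a direction of the orientation tuple all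
    adjacent sub-hexahedra use the same interval, and an integrated Legendre
    polynomial of degree at least 2 vanishes at both of its ends, so it extends
    by zero. The product [node_shape] of these one-dimensional functions is
    continuous on the whole space, vanishes off the adjacent sub-hexahedra and
    on the boundary of the cube, and its nonzero set is dense in each adjacent
    sub-hexahedron, since a nonzero polynomial has finitely many roots. On
    the element Q, the enrichment function is [node_shape] composed with the
    inverse element mapping ([enrichment_image]); this gives well-definedness.

    How Q sits in the domain follows from the decomposition alone. The other
    elements form a closed set that covers the rest of the closure of the domain
    and meets Q only in its boundary, where the enrichment function vanishes. Hence the function is continuous on
    two closed sets that cover the closure of the domain, so it is continuous
    there ([enrichment_continuous_closure]).

    For the support, the patch is compact and contains every point where the
    function is nonzero. Conversely, every neighbourhood of a point of the patch
    contains the image of a nonempty open subset V of the cube on which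
    [node_shape] is nonzero. An image point could a priori lie on the boundary
    of the domain, but the image of V is relatively open in the closure of the
    domain ([open_image_trace]), and therefore meets the domain itself. *)

Set Implicit Arguments.
Unset Strict Implicit.
Unset Printing Implicit Defensive.

(** * Polynomials *)

Section Poly.

(** Each derivative removes at most one factor q. *)
Lemma derivn_exp_dvd (R : comNzRingType) (q : {poly R}) k e :
  exists s, (q ^+ (k + e))^`(k) = q ^+ e * s.
Proof.
elim: k e => [|k IH] e; first by exists 1; rewrite derivn0 mulr1.
have [s es] := IH e.+1.
exists (q^`() * s *+ e.+1 + q * s^`()).
rewrite addSnnS derivnS es derivM deriv_exp exprS /= mulrDr.
congr (_ + _); last by rewrite mulrCA mulrA.
by rewrite mulrnAl mulrnAr mulrCA mulrA.
Qed.

Lemma derivn_neq0 (R : numDomainType) (p : {poly R}) k :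
  (k < size p)%N -> p^`(k) != 0.
Proof.
move=> kp; apply/negP => /eqP /(congr1 (fun q : {poly R} => q`_((size p).-1 - k))).
have p_gt0 : (0 < size p)%N by exact: leq_ltn_trans kp.
have k_le : (k <= (size p).-1)%N by rewrite -ltnS prednK.
rewrite coef_derivn subnKC// coef0 => /eqP.
rewrite mulrn_eq0 -lead_coefE lead_coef_eq0 -size_poly_eq0.
by rewrite !eqn0Ngt ffact_gt0 k_le p_gt0.
Qed.

(** Among the points a + (b - a) / (m + 2) there are more than the degree of p. *)
Lemma poly_nonroot_between (R : numFieldType) (p : {poly R}) (a b : R) :
  p != 0 -> a < b -> exists t, [/\ a < t, t < b & p.[t] != 0].
Proof.
move=> p0 ab; apply: contrapT => noroot.
pose pt (m : nat) := a + (b - a) / m.+2%:R.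
have ba : 0 < b - a by rewrite subr_gt0.
have pt_inj : injective pt.
  move=> m1 m2 /addrI /(mulfI (lt0r_neq0 ba)) /invr_inj /eqP.
  by rewrite eqr_nat => /eqP[].
have /allPn[t /mapP[m _ ->] pm] :
    ~~ all (root p) [seq pt m | m <- iota 0 (size p)].
  apply/negP => /(max_poly_roots p0).
  by rewrite map_inj_uniq// iota_uniq size_map size_iota ltnn => /(_ isT).
apply: noroot; exists (pt m); split => //.
  by rewrite ltrDl divr_gt0.
by rewrite -ltrBrDl gtr_pMr// invf_lt1// ltr1n.
Qed.

End Poly.

(** * Integrated Legendre polynomials *)

Section Bubble.
Variable R : realType.

(** The antiderivative of the Legendre polynomial of index [j.-1] obtained by
    taking one derivative fewer in Rodrigues' formula; meaningful for
    [2 <= j]. *)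
Definition bubble (j : nat) : {poly R} :=
  ((2 ^ j.-1 * (j.-1)`!)%:R)^-1 *: (('X^2 - 1) ^+ j.-1)^`(j.-2).

Lemma deriv_bubble j : (bubble j.+2)^`() = legendre R j.+1.
Proof. by rewrite /bubble derivZ -derivnS. Qed.

(** One factor X^2 - 1 of Rodrigues' formula survives the differentiations. *)
Lemma bubble_end j t : t ^+ 2 = 1 -> (bubble j.+2).[t] = 0.
Proof.
move=> t2; rewrite /bubble hornerZ -[j.+2.-2]/j -[j.+2.-1]/j.+1.
have [s] := derivn_exp_dvd ('X^2 - 1 : {poly R}) j 1.
rewrite addn1 => ->.
by rewrite expr1 hornerM hornerD hornerN hornerXn hornerC t2 subrr mul0r mulr0.
Qed.

Lemma bubble_neq0 j : bubble j.+2 != 0.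
Proof.
rewrite /bubble scaler_eq0 invr_eq0 pnatr_eq0 muln_eq0 expn_eq0.
have size_pred : (size (('X^2 - 1 : {poly R}) ^+ j.+1)).-1 = (2 * j.+1)%N.
  by rewrite size_exp -polyC1 size_XnsubC.
rewrite [_`! == 0%N]eqn0Ngt fact_gt0 /= derivn_neq0//.
by rewrite (leq_trans _ (leq_pred _))// size_pred leq_pmull.
Qed.

(** As [bubble] vanishes at -1, it is the antiderivative that [psi] selects. *)
Lemma psi_bubble j t : -1 <= t -> psi j.+2 t = (bubble j.+2).[t].
Proof.
rewrite le_eqVlt => /predU1P[<-|t1].
  by rewrite /psi set_itv1 Rintegral_set1 bubble_end// sqrrN expr1n.
rewrite /psi /Rintegral (@continuous_FTC2 _ _ (horner (bubble j.+2)))//.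
- by rewrite [X in (_ - X%:E)%E]bubble_end ?sqrrN ?expr1n// sube0.
- exact/continuous_subspaceT/continuous_horner.
- split=> [x _||]; first exact: derivable_horner.
  + exact/cvg_at_right_filter/continuous_horner.
  + exact/cvg_at_left_filter/continuous_horner.
- by move=> x _; rewrite -derivE deriv_bubble.
Qed.

End Bubble.

(** * Coordinates on the sub-hexahedra *)

Section Coord.
Context {R : realType} {d : nat}.
Variable z : 'rV[R]_d.
Hypothesis hz : forall k : 'I_d, -1 < z 0 k < 1.
Implicit Types (i : multibit d) (k : 'I_d) (t : R) (y w : 'rV[R]_d).

Lemma edge_lo_ge i k : -1 <= edge_lo z i k.
Proof. by rewrite /edge_lo; have := hz k; case: (i k) => // /andP[/ltW]. Qed.

Lemma edge_hi_le i k : edge_hi z i k <= 1.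
Proof. by rewrite /edge_hi; have := hz k; case: (i k) => // /andP[_ /ltW]. Qed.

Lemma edge_lt i k : edge_lo z i k < edge_hi z i k.
Proof.
by rewrite /edge_lo /edge_hi; have := hz k; case: (i k) => /andP[].
Qed.

Definition local_coord i k t : R :=
  2 * ((t - edge_lo z i k) / (edge_hi z i k - edge_lo z i k)) - 1.

Definition local_point i y : 'rV[R]_d := \row_k local_coord i k (y 0 k).

Definition global_point i w : 'rV[R]_d :=
  \row_k (edge_lo z i k + (w 0 k + 1) / 2 * (edge_hi z i k - edge_lo z i k)).

Lemma local_coord_gtN1 i k t : (-1 < local_coord i k t) = (edge_lo z i k < t).
Proof.
have e0 : 0 < edge_hi z i k - edge_lo z i k by rewrite subr_gt0 edge_lt.
rewrite /local_coord -subr_gt0 opprK addrNK pmulr_rgt0// pmulr_lgt0 ?invr_gt0//.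
by rewrite subr_gt0.
Qed.

Lemma local_coord_lt1 i k t : (local_coord i k t < 1) = (t < edge_hi z i k).
Proof.
have e0 : 0 < edge_hi z i k - edge_lo z i k by rewrite subr_gt0 edge_lt.
rewrite /local_coord ltrBlDr -[1 + 1]mulr1 ltr_pM2l// ltr_pdivrMr// mul1r.
by rewrite ltrD2r.
Qed.

Lemma local_coord_in i k t : t \in `[edge_lo z i k, edge_hi z i k] ->
  -1 <= local_coord i k t <= 1.
Proof.
have e0 : 0 < edge_hi z i k - edge_lo z i k by rewrite subr_gt0 edge_lt.
rewrite in_itv /= => /andP[lo hi]; rewrite /local_coord.
set r := _ / _.
have r0 : 0 <= r by rewrite divr_ge0 ?(ltW e0)// subr_ge0.
have r1 : r <= 1 by rewrite ler_pdivrMr// mul1r lerD2r.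
by apply/andP; split; lra.
Qed.

Lemma local_pointK i : cancel (local_point i) (global_point i).
Proof.
move=> y; apply/rowP => k; rewrite !mxE /local_coord.
have e0 : edge_hi z i k - edge_lo z i k != 0 by rewrite subr_eq0 gt_eqF ?edge_lt.
by field.
Qed.

Lemma global_pointK i : cancel (global_point i) (local_point i).
Proof.
move=> y; apply/rowP => k; rewrite !mxE /local_coord.
have e0 : edge_hi z i k - edge_lo z i k != 0 by rewrite subr_eq0 gt_eqF ?edge_lt.
by field.
Qed.

Lemma subcube_refcube i : subcube z i `<=` refcube (R := R) (d := d).
Proof.
move=> y + k => /(_ k); rewrite !in_itv /= => /andP[lo hi].
by rewrite (le_trans (edge_lo_ge i k))// (le_trans hi)// edge_hi_le.
Qed.

Lemma local_point_refcube i y : subcube z i y -> refcube (local_point i y).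
Proof. by move=> yi k; rewrite mxE in_itv /= local_coord_in. Qed.

Lemma global_point_refcube i w : refcube w -> refcube (global_point i w).
Proof.
move=> w1; apply: (@subcube_refcube i) => k; have := w1 k.
have e0 : 0 < edge_hi z i k - edge_lo z i k by rewrite subr_gt0 edge_lt.
rewrite !in_itv /= !mxE => /andP[wl wr]; apply/andP; split; nra.
Qed.

(** Pulled back to the reference cube, [zeta] does not involve the element
    mapping: the affine map onto the sub-hexahedron is inverted explicitly. *)
Lemma zeta_image (f : 'rV[R]_d -> 'rV[R]_d) i (j : 'I_d -> nat) y :
  {in refcube (d := d) &, injective f} -> subcube z i y ->
  zeta f z i j (f y) = psihat j (local_point i y).
Proof.
move=> finj yi; rewrite /zeta /= -[in f y](local_pointK i y).
rewrite -[f _]/(submap f z i (local_point i y)) /refcube_inv pinvKV//.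
  move=> v w; rewrite !inE => v1 w1 fvw.
  by apply: (can_inj (global_pointK i)); apply: finj fvw;
    rewrite inE; exact: global_point_refcube.
by rewrite inE; exact: local_point_refcube.
Qed.

End Coord.

(** * The node shape function on the reference cube *)

Section Node.
Context {R : realType} {d : nat} (z : 'rV[R]_d) (n : internal_node d)
  (p : (node_dim n).-tuple nat).
Hypothesis hz : forall k : 'I_d, -1 < z 0 k < 1.
Hypothesis p_ge2 : forall m, (2 <= tnth p m)%N.
Implicit Types (i : multibit d) (k : 'I_d) (t : R) (y w : 'rV[R]_d).

(** The adjacent multi-indices agree in the directions of the orientation tuple;
    this is the one among them whose remaining entries are [false]. It serves to
    name the common interval in an orientation direction. *)
Definition node_corner : multibit d :=
  [ffun k => nth false (location n) (index k (orientation n))].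

Definition node_degree k : nat := nth 0%N p (index k (orientation n)).

Lemma node_adjacentP i :
  reflect {in orientation n, i =1 node_corner} (node_adjacent n i).
Proof.
apply: (iffP forallP) => [in_i k kn|in_i m].
  have lt_k : (index k (orientation n) < node_dim n)%N.
    by rewrite -{2}(size_tuple (orientation n)) index_mem.
  have /eqP := in_i (Ordinal lt_k).
  by rewrite (tnth_nth k) (tnth_nth false) /= nth_index// ffunE.
rewrite in_i ?mem_tnth// ffunE (tnth_nth (tnth (orientation n) m)).
rewrite index_uniq ?size_tuple ?(tnth_nth false)//.
apply: sorted_uniq (orientation_sorted n) => [k1 k2 k3|k]; first exact: ltn_trans.
exact: ltnn.
Qed.

Lemma node_degree_ge2 k : k \in orientation n -> (2 <= node_degree k)%N.
Proof.
move=> kn; have lt_k : (index k (orientation n) < node_dim n)%N.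
  by rewrite -{2}(size_tuple (orientation n)) index_mem.
by have := p_ge2 (Ordinal lt_k); rewrite (tnth_nth 0%N).
Qed.

(** Both branches are continuous closed formulas for functions defined piecewise.
    Clamping the local coordinate to [-1, 1] extends the bubble by its end values,
    which are 0; the maximum with 0 of the minimum of two affine functions is the
    hat function with peak at the dividing point. *)
Definition node_factor k t : R :=
  if k \in orientation n then
    (bubble R (node_degree k)).[
      Num.max (-1) (Num.min 1 (local_coord z node_corner k t))]
  else Num.max 0 (Num.min ((1 + t) / (1 + z 0 k)) ((1 - t) / (1 - z 0 k))).

Definition node_shape y : R := \prod_(k < d) node_factor k (y 0 k).

Lemma node_factor_continuous k : continuous (node_factor k).
Proof.
move=> t; rewrite /node_factor; case: (k \in orientation n) => /=.
  pose c s := local_coord z node_corner k s.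
  have c_cont : {for t, continuous c}.
    apply: cvgB; last exact: cvg_cst.
    apply: cvgM; first exact: cvg_cst.
    apply: cvgM; last exact: cvg_cst.
    by apply: cvgB; [exact: cvg_id|exact: cvg_cst].
  apply: (@continuous_comp _ _ _ (fun s => Num.max (-1) (Num.min 1 (c s)))
    (horner (bubble R _))); last exact: continuous_horner.
  apply: (@continuous_max _ _ (cst (-1)) (fun s => Num.min 1 (c s))).
    exact: cvg_cst.
  by apply: (@continuous_min _ _ (cst 1) c) => //; exact: cvg_cst.
apply: (@continuous_max _ _ (cst 0)
  (fun t => Num.min ((1 + t) / _) ((1 - t) / _))); first exact: cvg_cst.
apply: (@continuous_min _ _ (fun t => (1 + t) / _) (fun t => (1 - t) / _)).
  apply: cvgM; last exact: cvg_cst.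
  by apply: cvgD; [exact: cvg_cst|exact: cvg_id].
apply: cvgM; last exact: cvg_cst.
by apply: cvgB; [exact: cvg_cst|exact: cvg_id].
Qed.

Lemma node_shape_continuous : continuous node_shape.
Proof.
move=> y; have mulc : continuous (fun v : R * R => v.1 * v.2) by exact: mul_continuous.
apply: (@cvg_big R _ *%R 1 xpredT mulc _ (nbhs y) _
  (fun k w => node_factor k (w 0 k))).
move=> k _; apply: (@continuous_comp _ _ _ (fun w : 'rV[R]_d => w 0 k)).
  exact: coord_continuous.
exact: node_factor_continuous.
Qed.

Lemma node_edgeE i k : node_adjacent n i -> k \in orientation n ->
  (edge_lo z i k = edge_lo z node_corner k) *
  (edge_hi z i k = edge_hi z node_corner k).
Proof. by move=> /node_adjacentP ni kn; rewrite /edge_lo /edge_hi ni. Qed.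

(** The agreement of all the pieces, one direction at a time. *)
Lemma node_factorE i k t : node_adjacent n i ->
  t \in `[edge_lo z i k, edge_hi z i k] ->
  psi (shape_index i p k) (local_coord z i k t) = node_factor k t.
Proof.
move=> ni ti; have /andP[l u] := local_coord_in hz ti.
rewrite /shape_index /node_factor; case: ifP => kn.
  have -> : local_coord z i k t = local_coord z node_corner k t.
    by rewrite /local_coord !(node_edgeE ni kn).
  move: l u; rewrite /local_coord !(node_edgeE ni kn) => l u.
  rewrite -/(node_degree k).
  have := node_degree_ge2 kn; case: (node_degree k) => [|[|j]]// _.
  by rewrite (min_r u) (max_r l) psi_bubble.
have /andP[zl zu] := hz k.
have z1 : 0 < 1 + z 0 k by lra.
have z2 : 0 < 1 - z 0 k by lra.
move: ti; rewrite in_itv /local_coord /edge_lo /edge_hi.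
(* The value 1, taken by both affine branches at z, separates them. *)
case: (i k) => /= /andP[tl tu] /=.
  rewrite min_r ?max_r.
  - by field; rewrite gt_eqF.
  - by rewrite divr_ge0// ?(ltW z2)// subr_ge0.
  - by rewrite (@le_trans _ _ 1)// ?ler_pdivrMr// ?ler_pdivlMr// mul1r; lra.
rewrite min_l ?max_r.
- by field; rewrite gt_eqF.
- by rewrite divr_ge0// ?(ltW z1)//; lra.
- by rewrite (@le_trans _ _ 1)// ?ler_pdivrMr// ?ler_pdivlMr// mul1r; lra.
Qed.

Lemma psihat_node_shape i y : node_adjacent n i -> subcube z i y ->
  psihat (shape_index i p) (local_point z i y) = node_shape y.
Proof.
move=> ni yi; apply: eq_bigr => k _.
by rewrite mxE node_factorE.
Qed.

Lemma node_factor_supp k t : node_factor k t != 0 ->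
  -1 < t < 1 /\
  (k \in orientation n -> edge_lo z node_corner k < t < edge_hi z node_corner k).
Proof.
rewrite /node_factor; case: ifP => kn nz.
  have lu : edge_lo z node_corner k < t < edge_hi z node_corner k.
    apply/negPn; apply: contra nz; rewrite negb_and.
    rewrite -(local_coord_gtN1 hz) -(local_coord_lt1 hz) -!leNgt.
    have := node_degree_ge2 kn; case: (node_degree k) => [|[|j]]// _.
    move=> /orP[l|u].
      by rewrite max_l ?bubble_end// ?sqrrN ?expr1n// ge_min l orbT.
    by rewrite (min_l u) max_r ?bubble_end ?expr1n//; lra.
  split=> //; have /andP[l u] := lu.
  by rewrite (le_lt_trans (edge_lo_ge hz node_corner k))//=
     (lt_le_trans u)// edge_hi_le.
split=> //; apply/negPn; apply: contra nz; rewrite negb_and -!leNgt => t_out.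
have /andP[zl zu] := hz k.
rewrite max_l// ge_min; case/orP: t_out => t_out; apply/orP; [left|right].
- by rewrite pmulr_lle0 ?invr_gt0; lra.
- by rewrite pmulr_lle0 ?invr_gt0; lra.
Qed.

Lemma node_shape_interior y : node_shape y != 0 -> forall k, -1 < y 0 k < 1.
Proof. by move=> /prodf_neq0 nz k; have [] := node_factor_supp (nz k isT). Qed.

(** In the directions off the orientation tuple the two halves of [-1, 1] cover
    everything, and in the others [node_factor] vanishes off the common interval. *)
Lemma node_shape_patch y : node_shape y != 0 ->
  exists2 i, node_adjacent n i & subcube z i y.
Proof.
move=> /prodf_neq0 nz.
exists [ffun k => if k \in orientation n then node_corner k else z 0 k <= y 0 k].
  by apply/node_adjacentP => k kn; rewrite ffunE kn.
move=> k; have [/andP[yl yu] corner_bound] := node_factor_supp (nz k isT).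
rewrite in_itv /= /edge_lo /edge_hi ffunE.
case: (boolP (k \in orientation n)) => kn.
  by have /andP[/ltW + /ltW] := corner_bound kn; rewrite /edge_lo /edge_hi => -> ->.
by case: (leP (z 0 k) (y 0 k)) => [zy|/ltW zy]; rewrite ?zy ?(ltW yl) ?(ltW yu).
Qed.

(** In the open interval, [node_factor] is nonzero wherever some nonzero polynomial
    is; a nonroot of that polynomial exists arbitrarily close to t. *)
Lemma node_factor_near i k t e : node_adjacent n i -> 0 < e ->
  t \in `[edge_lo z i k, edge_hi z i k] ->
  exists s, [/\ `|t - s| < e & node_factor k s != 0].
Proof.
move=> ni e0; rewrite in_itv /= => /andP[tl tu].
have lh := edge_lt hz i k.
pose a := Num.max (edge_lo z i k) (t - e).
pose b := Num.min (edge_hi z i k) (t + e).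
have ab : a < b.
  by rewrite lt_min !gt_max lh /=; apply/and3P; split; lra.
have [j pj j_nz] : exists2 q : {poly R}, q != 0 &
    forall s, edge_lo z i k < s < edge_hi z i k -> q.[s] != 0 -> node_factor k s != 0.
  case: (boolP (k \in orientation n)) => kn; last first.
    (* The hat function has no zero in the open interval. *)
    exists 1 => [|s /andP[sl su] _]; first exact: oner_neq0.
    have s1 := le_lt_trans (edge_lo_ge hz i k) sl.
    have s2 := lt_le_trans su (edge_hi_le hz i k).
    have /andP[zl zu] := hz k.
    rewrite /node_factor (negbTE kn) gt_eqF// lt_max lt_min orbC.
    by rewrite !divr_gt0//; lra.
  pose c := 2 / (edge_hi z i k - edge_lo z i k).
  have c0 : c != 0 by rewrite gt_eqF// divr_gt0// subr_gt0.
  pose l : {poly R} := c *: ('X - (edge_lo z i k)%:P) - 1.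
  have size_l : size l = 2.
    by rewrite /l size_polyDl size_scale ?size_XsubC// size_polyN size_poly1.
  have lE s : l.[s] = local_coord z node_corner k s.
    rewrite /l /c hornerD hornerN hornerZ hornerXsubC hornerC /local_coord.
    by rewrite !(node_edgeE ni kn) -mulrA [X in 2 * X]mulrC.
  exists (bubble R (node_degree k) \Po l) => [|s /andP[sl su]].
    rewrite comp_poly_eq0 ?size_l//.
    by have := node_degree_ge2 kn; case: node_degree => [|[|j]]// _; exact: bubble_neq0.
  rewrite horner_comp lE /node_factor kn => nz.
  rewrite min_r ?max_r// ltW ?(local_coord_gtN1 hz) ?(local_coord_lt1 hz)//.
    by rewrite -(node_edgeE ni kn).
  by rewrite -(node_edgeE ni kn).
have [s [as_ sb /j_nz nz]] := poly_nonroot_between pj ab.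
move: as_ sb; rewrite gt_max lt_min => /andP[a1 a2] /andP[b1 b2].
exists s; split; first by rewrite ltr_norml; lra.
by apply: nz; rewrite a1 b1.
Qed.

End Node.

(** * Topology of a decomposition near an element *)

Section Top.
Context {R : realType} {d : nat}.

Lemma box_compact (a b : 'I_d -> R) :
  compact [set x : 'rV[R]_d | forall k, x 0 k \in `[a k, b k]].
Proof.
apply: (@rV_compact R d (fun k => `[a k, b k]%classic)) => k.
exact: segment_compact.
Qed.

Lemma open_cube_open : open [set y : 'rV[R]_d | forall k, -1 < y 0 k < 1].
Proof.
rewrite openE => y y1.
apply: (@filter_forall _ _ (fun k (w : 'rV[R]_d) => -1 < w 0 k < 1) (nbhs y)) => k.
apply: (@coord_continuous _ 1 d 0 k y (fun t : R => -1 < t < 1)).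
apply: open_nbhs_nbhs; split; last exact: y1.
have -> : (fun t : R => -1 < t < 1) = `]-1, 1[%classic :> set R.
  by apply/seteqP; split => t; rewrite /= in_itv.
exact: itv_open.
Qed.

Lemma element_mapping_image_closed Q (f : 'rV[R]_d -> 'rV[R]_d) K :
  element_mapping Q f -> compact K -> K `<=` refcube (d := d) -> closed (f @` K).
Proof.
move=> fQ cK sK; apply: compact_closed; first exact: norm_hausdorff.
apply: continuous_compact cK.
exact: continuous_subspaceW sK (element_mapping_continuous fQ).
Qed.

Lemma refcube_invK Q (f : 'rV[R]_d -> 'rV[R]_d) y :
  element_mapping Q f -> refcube y -> refcube_inv f (f y) = y.
Proof.
move=> /element_mapping_bij[_ finj _] y1.
by rewrite /refcube_inv pinvKV// inE.
Qed.

Section Decomposition.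
Variables (Omega : set 'rV[R]_d) (Qs : set (set 'rV[R]_d)).
Variable F : set 'rV[R]_d -> 'rV[R]_d -> 'rV[R]_d.
Hypothesis hQs : decomposition Omega Qs F.
Variable Q : set 'rV[R]_d.
Hypothesis hQ : Qs Q.

Definition other_elements : set 'rV[R]_d := \bigcup_(Q' in Qs `\ Q) Q'.

Lemma element_image Q' : Qs Q' -> F Q' @` refcube (d := d) = Q'.
Proof.
move=> /(decomposition_mapping hQs)/element_mapping_bij[fQ _ sQ].
by apply/seteqP; split => // x [y y1 <-]; exact: fQ.
Qed.

Lemma element_closed Q' : Qs Q' -> closed Q'.
Proof.
move=> Q'Q; rewrite -(element_image Q'Q).
apply: element_mapping_image_closed (decomposition_mapping hQs Q'Q) _ _ => //.
exact: box_compact.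
Qed.

Lemma other_elements_closed : closed other_elements.
Proof.
apply: closed_bigcup => [|Q' [Q'Q _]]; last exact: element_closed.
exact: finite_setD (decomposition_finite hQs).
Qed.

Lemma closure_domainE : closure Omega = Q `|` other_elements.
Proof.
rewrite -(decomposition_cover hQs); apply/seteqP; split => x.
  move=> [Q' Q'Q xQ']; have [<-|neq] := pselect (Q' = Q); first by left.
  by right; exists Q'.
by move=> [xQ|[Q' [Q'Q _] xQ']]; [exists Q|exists Q'].
Qed.

(** Elements overlap only along their boundaries, and the element mapping is
    injective. *)
Lemma interior_not_other y : (refcube (d := d))° y -> ~ other_elements (F Q y).
Proof.
move=> y_int [Q' [Q'Q neq] yQ'].
have y1 : refcube y := interior_subset y_int.
have fQ := decomposition_mapping hQs hQ.
have yQ : Q (F Q y) by rewrite -{1}(element_image hQ); exists y.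
have [[v [v1 v_int] vy] _] :=
  decomposition_overlap hQs hQ Q'Q (nesym neq) (conj yQ yQ').
apply: v_int; suff -> : v = y by [].
by rewrite -(refcube_invK fQ v1) vy (refcube_invK fQ y1).
Qed.

(** The complement of the other elements
    and of the compact image of the rest of the cube is open, and what it leaves
    of the closure of the domain is exactly the image of V. *)
Lemma open_image_trace V : open V -> V `<=` refcube (d := d) ->
  exists2 W, open W & closure Omega `&` W = F Q @` V.
Proof.
move=> oV sV; have fQ := decomposition_mapping hQs hQ.
exists (~` (F Q @` (refcube (d := d) `\` V) `|` other_elements)).
  apply/closed_openC/closedU; last exact: other_elements_closed.
  apply: element_mapping_image_closed fQ _ _; last by move=> y [].
  apply: subclosed_compact (@box_compact (fun=> -1) (fun=> 1)) _.
    apply: closedI; last exact: open_closedC.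
    apply: compact_closed (@box_compact (fun=> -1) (fun=> 1)).
    exact: norm_hausdorff.
  by move=> y [].
rewrite closure_domainE; apply/seteqP; split => x.
  move=> [[xQ|xo] /not_orP[nV no]] //.
  move: xQ; rewrite -{1}(element_image hQ) => -[y y1 yx].
  by exists y => //; apply: contrapT => yV; apply: nV; exists y.
move=> [y yV <-]; split.
  by left; rewrite -{1}(element_image hQ); exists y => //; exact: sV.
move=> [[v [v1 vV] vy]|].
  apply: vV; suff -> : v = y by [].
  by rewrite -(refcube_invK fQ v1) vy (refcube_invK fQ (sV _ yV)).
have sV_int : V `<=` (refcube (d := d))° by rewrite -open_subsetE.
exact/interior_not_other/sV_int.
Qed.

End Decomposition.
End Top.

(** * The enrichment function as a transported node shape function *)

Section Enrichment.
Context {R : realType} {d : nat} (Q : set 'rV[R]_d) (f : 'rV[R]_d -> 'rV[R]_d).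
Variables (z : 'rV[R]_d) (n : internal_node d) (p : (node_dim n).-tuple nat).
Hypothesis fQ : element_mapping Q f.
Hypothesis hz : forall k : 'I_d, -1 < z 0 k < 1.
Hypothesis p_ge2 : forall m, (2 <= tnth p m)%N.

Lemma zeta_node_shape i y : node_adjacent n i -> subcube z i y ->
  zeta f z i (shape_index i p) (f y) = node_shape z p y.
Proof.
move=> ni yi; rewrite zeta_image ?psihat_node_shape//.
by have [] := element_mapping_bij fQ.
Qed.

(** The value does not depend on the sub-hexahedron that is picked, because
    [node_shape] does not refer to one. *)
Lemma enrichment_image y : refcube y ->
  enrichment f z p (f y) = node_shape z p y.
Proof.
move=> y1; rewrite /enrichment; case: pickP => [i|none].
  move=> /andP[ni]; rewrite inE => -[v vi vy].
  by rewrite -vy zeta_node_shape// -(refcube_invK fQ y1) -vy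
    (refcube_invK fQ)//; exact: subcube_refcube vi.
apply/esym/eqP/negPn/negP => /(node_shape_patch hz p_ge2)[i ni yi].
by have /negP := none i; apply; rewrite ni inE; exists y.
Qed.

Lemma enrichment_off_patch x : ~ node_patch f z n x -> enrichment f z p x = 0.
Proof.
move=> nx; rewrite /enrichment; case: pickP => // i /andP[ni].
by rewrite inE => xi; case: nx; exists i.
Qed.

Lemma node_shape_near i y N : node_adjacent n i -> subcube z i y -> nbhs y N ->
  exists2 v, N v & node_shape z p v != 0.
Proof.
move=> ni yi /nbhs_ballP[e /= e0 eN].
have near_k k := node_factor_near hz p_ge2 ni e0 (yi k).
have [s near_s] := choice near_k.
exists (\row_k s k).
  by apply: eN; split=> // a k; rewrite ord1 mxE; have [] := near_s k.
by apply/prodf_neq0 => k _; rewrite mxE; have [] := near_s k.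
Qed.

Lemma node_patch_closed : closed (node_patch f z n).
Proof.
apply: closed_bigcup => [|i _]; first exact: finite_finset.
apply: element_mapping_image_closed fQ _ _; last exact: subcube_refcube.
exact: box_compact.
Qed.

End Enrichment.

(** * Continuity and support in the domain *)

Section MeshEnrichment.
Context {R : realType} {d : nat} (Omega : set 'rV[R]_d).
Variables (Qs : set (set 'rV[R]_d)) (F : set 'rV[R]_d -> 'rV[R]_d -> 'rV[R]_d).
Hypothesis hQs : decomposition Omega Qs F.
Variable Q : set 'rV[R]_d.
Hypothesis hQ : Qs Q.
Variables (z : 'rV[R]_d) (n : internal_node d) (p : (node_dim n).-tuple nat).
Hypothesis hz : forall k : 'I_d, -1 < z 0 k < 1.
Hypothesis p_ge2 : forall m, (2 <= tnth p m)%N.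
Let fQ : element_mapping Q (F Q) := decomposition_mapping hQs hQ.

(** A point shared with another element lies on the boundary of Q, where
    [node_shape] vanishes. *)
Lemma enrichment_other x : other_elements Qs Q x -> enrichment (F Q) z p x = 0.
Proof.
move=> xo; have [[i ni [y yi yx]]|] := pselect (node_patch (F Q) z n x); last first.
  exact: enrichment_off_patch.
rewrite -yx in xo *; apply/eqP/negPn/negP.
have y1 := subcube_refcube hz yi.
rewrite (enrichment_image fQ)// => /(node_shape_interior hz p_ge2) y_int.
apply: (interior_not_other hQs hQ _ xo).
rewrite /interior; apply: filterS (open_nbhs_nbhs (conj open_cube_open y_int)).
by move=> v v_int k; have /andP[l u] := v_int k; rewrite in_itv /= !ltW.
Qed.

Lemma enrichment_continuous_closure :
  {within closure Omega, continuous (enrichment (F Q) z p)}.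
Proof.
rewrite (closure_domainE hQs hQ).
apply: withinU_continuous.
- exact: (element_closed hQs hQ).
- exact: (other_elements_closed hQs).
- apply: (@subspace_eq_continuous _ _ _ (node_shape z p \o refcube_inv (F Q))).
    move=> x; rewrite inE -{1}(element_image hQs hQ) => -[y y1 <-].
    by rewrite /from_subspace /comp (enrichment_image fQ)// (refcube_invK fQ).
  move=> x; apply: (@continuous_comp (subspace Q) 'rV[R]_d R (refcube_inv (F Q)));
    last exact: node_shape_continuous.
  exact: (element_mapping_inv_continuous fQ).
- apply: (@subspace_eq_continuous _ _ _ (cst 0)); last by move=> x; exact: cvg_cst.
  by move=> x; rewrite inE /from_subspace => /enrichment_other ->.
Qed.

Lemma support_enrichment :
  support_in Omega (enrichment (F Q) z p) = node_patch (F Q) z n.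
Proof.
apply/seteqP; split.
  rewrite /support_in [X in _ `<=` X](closure_id _).1; last first.
    exact: (node_patch_closed fQ hz).
  apply: closureS => x [_ nz]; apply: contrapT => /enrichment_off_patch x0.
  by rewrite x0 eqxx in nz.
move=> x [i ni [y yi <-]] B nB.
(* v is close to y and has a nonzero value; V is an open set around it whose
   image lies in B. The image of V meets the domain itself. *)
have y1 := subcube_refcube hz yi.
have /subspace_continuousP/(_ y y1 B nB) nN := element_mapping_continuous fQ.
have [v vN v_nz] := node_shape_near hz p_ge2 ni yi (nbhs_interior nN).
pose V := (fun w => refcube w -> B (F Q w))° `&`
  ([set w : 'rV[R]_d | forall k, -1 < w 0 k < 1] `&`
   node_shape z p @^-1` [set t | t != 0]).
have oV : open V.
  apply: openI; first exact: open_interior.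
  apply: openI; first exact: open_cube_open.
  apply: open_comp => [w _|]; first exact: node_shape_continuous.
  exact: open_neq.
have sV : V `<=` refcube (d := d).
  by move=> w [_ [w_int _]] k; have /andP[l u] := w_int k; rewrite in_itv /= !ltW.
have vV : V v by split=> //; split=> //; exact: node_shape_interior v_nz.
have [W oW WV] := open_image_trace hQs hQ oV sV.
have [cv Wv] : (closure Omega `&` W) (F Q v) by rewrite WV; exists v.
have [x' [x'O x'W]] := cv W (open_nbhs_nbhs (conj oW Wv)).
have : (closure Omega `&` W) x' by split=> //; exact: subset_closure.
rewrite WV => -[w wV wx']; exists x'; split.
  split=> //; rewrite -wx' (enrichment_image fQ)//; last exact: sV.
  by have [_ []] := wV.
rewrite -wx'; have [wN _] := wV; exact: (interior_subset wN) (sV _ wV).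
Qed.

End MeshEnrichment.

Theorem theorem18 (R : realType) (d : nat) (Omega : set 'rV[R]_d)
    (Qs : set (set 'rV[R]_d)) (F : set 'rV[R]_d -> 'rV[R]_d -> 'rV[R]_d)
    (hOmega : bounded_lipschitz_domain Omega)
    (hQs : decomposition Omega Qs F)
    (Q : set 'rV[R]_d) (hQ : Qs Q)
    (z : 'rV[R]_d) (hz : forall k : 'I_d, -1 < z 0 k < 1)
    (P : forall n : internal_node d, set ((node_dim n).-tuple nat))
    (hPfin : forall n, finite_set (P n))
    (hPge2 : forall n p, P n p -> forall m, (2 <= tnth p m)%N)
    (n : internal_node d) (p : (node_dim n).-tuple nat) (hp : P n p) :
  [/\ (* the defining cases agree on overlaps, so the function is well defined *)
      forall i x, node_adjacent n i -> Omega x -> subelement (F Q) z i x ->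
        enrichment (F Q) z p x = zeta (F Q) z i (shape_index i p) x,
      {within Omega, continuous (enrichment (F Q) z p)} &
      support_in Omega (enrichment (F Q) z p) = node_patch (F Q) z n].
Proof.
have p_ge2 := hPge2 _ _ hp.
have fQ := decomposition_mapping hQs hQ.
split.
- move=> i x ni _ [y yi <-].
  rewrite (enrichment_image fQ)//; last exact: subcube_refcube yi.
  by rewrite (zeta_node_shape fQ).
- apply: (continuous_subspaceW (@subset_closure _ Omega)).
  exact: (enrichment_continuous_closure hQs hQ).
- exact: (support_enrichment hQs hQ).
Qed.
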